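(* Let $U\subseteq\mathbb{R}^d$ be open and convex, and let $f:U\to\mathbb{R}$ be properly convex and $C^1$. Then $f$ can be approximated by $C^\infty$ convex functions in the $C^1$-fine topology; that is, for every continuous function $\varepsilon:U\to(0,\infty)$ there exists a convex function $g\in C^\infty(U)$ such that $|f(x)-g(x)|\leq\varepsilon(x)$ and $\|Df(x)-Dg(x)\|\leq\varepsilon(x)$ for all $x\in U$.
   Context: $f:U\to\mathbb{R}$ is properly convex if $f=\ell+c$, where $\ell$ is linear and $c:U\to[a,b)$, with $-\infty<a<b\leq\infty$, is convex and proper, meaning that $c^{-1}([a,\beta])$ is compact for every $\beta\in[a,b)$. *)

(* Defs.v *)
From HB Require Import structures.
From mathcomp Require Import all_boot all_order all_algebra.
From mathcomp Require Import all_classical all_reals all_analysis.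

Set Implicit Arguments.
Unset Strict Implicit.
Unset Printing Implicit Defensive.

Import Order.TTheory GRing.Theory Num.Theory.
Import numFieldNormedType.Exports.

Local Open Scope classical_set_scope.
Local Open Scope ring_scope.

(* R^d is 'rV[R]_d with its library topology (that of the sup norm, which is
   the usual one). A function on an open U is a total function of which only
   the values on U matter; its differential at a point of U depends only on
   these. *)

(* f = l + c on U with l linear and c : U -> [a, b) convex and proper. The
   bound b may be +oo, and -oo is excluded by a < b. *)
Definition properly_convex (R : realType) (d : nat) (U : set 'rV[R]_d)
    (f : 'rV[R]_d -> R) : Prop :=
  exists (l : {scalar 'rV[R]_d}) (c : 'rV[R]_d -> R) (a : R) (b : \bar R),
    [/\ (a%:E < b)%E,
        (forall x, U x -> f x = l x + c x),
        (forall x, U x -> a <= c x /\ ((c x)%:E < b)%E),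
        convex_function U c &
        (forall beta : R, a <= beta -> (beta%:E < b)%E ->
           compact (U `&` c @^-1` `[a, beta]%classic))].

(* C^k on the open set U: f is C^(k+1) when it is Frechet differentiable on U
   and Df is C^k. As the dual of R^d is finite dimensional, Df is C^k if and
   only if x |-> Df(x)(v) = 'D_v f x is C^k for every v. *)
Fixpoint Ck (R : realType) (d : nat) (k : nat) (U : set 'rV[R]_d)
    (f : 'rV[R]_d -> R) : Prop :=
  match k with
  | 0 => {within U, continuous f}
  | k'.+1 => (forall x, U x -> differentiable f x) /\
             (forall v : 'rV[R]_d, Ck k' U ('D_v f))
  end.

Definition Cinfty (R : realType) (d : nat) (U : set 'rV[R]_d)
    (f : 'rV[R]_d -> R) : Prop := forall k, Ck k U f.

(* The library norm on 'rV[R]_d is the sup norm. *)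
Definition euclidean_norm (R : realType) (d : nat) (v : 'rV[R]_d) : R :=
  Num.sqrt (\sum_(i < d) v ord0 i ^+ 2).

Definition operator_norm (R : realType) (d : nat) (L : {scalar 'rV[R]_d}) : R :=
  sup [set `|L v| | v in [set v | euclidean_norm v <= 1]].

(* Main.v *)
Require Import Defs.
From mathcomp Require Import all_boot all_order all_algebra.
From mathcomp Require Import all_classical all_reals all_analysis.
From mathcomp Require Import ring lra.
Import Order.TTheory GRing.Theory Num.Theory.
Import numFieldNormedType.Exports.
Local Open Scope classical_set_scope.
Local Open Scope ring_scope.

(** Subtracting the linear part of f leaves a convex proper C^1 function c on U
    with compact sublevel sets, exhausting U; the linear part is smooth and is
    added back at the end. Two ideas carry the proof.

    C^0 closeness is enough. If a convex function g is within e of a convex C^1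
    function f around x, then comparing difference quotients of a fixed step r
    shows that Dg(x) and Df(x) differ by the oscillation of Df on a ball of
    radius r plus a multiple of e / r. By compactness, on each compact part of U
    some constant e forces the required C^1 estimate ([uniform_C1_control]). It
    remains to find a smooth convex g such that |c - g| <= e_k where c > t_k,
    for levels t_k increasing to the upper bound of c and any given positive e_k
    ([fine_convex_approx]).

    Construction of g. Smooth convex functions are glued by a smoothed maximum
    u + e * hinge ((v - u) / e), where hinge x = x exp(-1/x) for x > 0 and 0 for
    x <= 0. It is smooth and convex, it lies between max u v - e and max u v, and
    it is equal to u wherever v <= u. By compactness, finitely many tangent planes
    of a convex function psi, glued to g one after the other, raise g to psi
    up to a prescribed gap on a given compact set, without ever exceeding
    max g psi ([patch_tangents]).

    This is iterated with psi_n = c + s_n (t_{n+1} - c), where the slopes s_n are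
    small and decreasing. The functions psi_n are convex and slightly above c on
    {c <= t_n}, and there psi_{n+1} lies below psi_n by a positive gap
    ([convex_gap_sequences]). After step n the approximant exceeds all later psi_m on {c <= t_n}, hence
    is never modified there again. The stationary limit is therefore convex, is
    locally equal to a smooth function, and has the required closeness to c. *)

Set Implicit Arguments.
Unset Strict Implicit.
Unset Printing Implicit Defensive.

(** * A smooth convex hinge on the real line *)

Section FlatHinge.
Context {R : realType}.
Implicit Types (x p : R) (k n : nat) (phi psi : R -> R).

(** C^k for functions of one variable. Asking for some derivative, instead of
    using the derivation operator, makes the class visibly closed under linear
    combinations and explicit recurrences. *)
Fixpoint smooth1 k phi : Prop :=
  match k with
  | 0 => continuous phi
  | k'.+1 => exists psi, (forall x, is_derive x 1 phi (psi x)) /\ smooth1 k' psi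
  end.

Lemma smooth1_continuous k phi : smooth1 k phi -> continuous phi.
Proof.
case: k => [//|k] [psi [dphi _]] x.
by apply/differentiable_continuous/derivable1_diffP; case: (dphi x).
Qed.

Lemma smooth1W k phi : smooth1 k.+1 phi -> smooth1 k phi.
Proof.
elim: k phi => [|k IH] phi; first exact: smooth1_continuous.
by move=> [psi [dphi /IH spsi]]; exists psi.
Qed.

Lemma smooth1_comb k (a b : R) phi psi : smooth1 k phi -> smooth1 k psi ->
  smooth1 k (fun x => a * phi x + b * psi x).
Proof.
elim: k phi psi => [|k IH] phi psi /=.
  move=> cphi cpsi x; apply: cvgD; apply: cvgM; try exact: cvg_cst.
  - exact: cphi.
  - exact: cpsi.
move=> [phi' [dphi sphi']] [psi' [dpsi spsi']].
exists (fun x => a * phi' x + b * psi' x); split; last exact: IH.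
by move=> x; apply: is_deriveD; apply: is_deriveZ.
Qed.

(** This family is closed under differentiation up to linear combinations:
    the derivative of flat n is flat (n + 2) - n flat (n + 1). *)
Definition flat n : R -> R := fun x => if 0 < x then x ^- n * expR (- x^-1) else 0.

Lemma flat_le0 n x : x <= 0 -> flat n x = 0.
Proof. by rewrite /flat leNgt => /negbTE ->. Qed.

Lemma flat_ge0 n x : 0 <= flat n x.
Proof.
rewrite /flat; case: ifPn => // x0; rewrite mulr_ge0 ?expR_ge0//.
by rewrite invr_ge0 exprn_ge0 // ltW.
Qed.

(** The quadratic bound gives a zero derivative at the origin; it follows from
    y^(n+2) <= (n+2)! exp y at y = 1/x. *)
Lemma flat_bound n x : flat n x <= n.+2`!%:R * x ^+ 2.
Proof.
rewrite /flat; case: ifPn => x0; last by rewrite mulr_ge0 ?sqr_ge0.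
have xi0 : 0 < x^-1 by rewrite invr_gt0.
have fp : 0 < n.+2`!%:R :> R by rewrite ltr0n fact_gt0.
have := expR_ge1Dxn n.+1 (ltW xi0).
rewrite expRN => h.
have {}h : (x^-1) ^+ n.+2 <= n.+2`!%:R * expR x^-1.
  rewrite mulrC -ler_pdivrMr //; apply: le_trans h.
  by rewrite lerDr.
rewrite ler_pdivrMr ?expR_gt0 // mulrAC.
rewrite -ler_pdivrMr ?exprn_gt0 //; apply: le_trans h.
by rewrite -exprVn -exprVn -exprD addn2.
Qed.

Lemma flat_derive n x :
  is_derive x 1 (flat n) (1 * flat n.+2 x + (- n%:R) * flat n.+1 x).
Proof.
have [x0|x0|->] := ltgtP x 0.
- rewrite !flat_le0 ?ltW// !mulr0 addr0.
  have D : is_derive x 1 (cst 0 : R -> R) 0 by exact: is_derive_cst.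
  apply: near_eq_is_derive D.
  near=> y; rewrite /= flat_le0//.
  by near: y; apply: filterS (lt_nbhsl x0) => y /ltW.
- have xn0 : x != 0 by rewrite gt_eqF.
  have dV : is_derive x 1 (fun y : R => y^-1) (- x^-2).
    have := @is_deriveV R id x 1 1 xn0 (is_derive_id _ _).
    by move=> h; apply: is_derive_eq h _; rewrite /= scaler1.
  have dE : is_derive x 1 (fun y : R => expR (- y^-1)) (x^-2 * expR (- x^-1)).
    have dN : is_derive x 1 (fun y : R => - y^-1) (x^-2).
      by apply: is_derive_eq (is_deriveN dV) _; rewrite opprK.
    have := @is_derive1_comp R expR (fun y => - y^-1) x _ _ (is_derive_expR (- x^-1)) dN.
    by move=> h; apply: is_derive_eq h _; rewrite /= mulrC.
  have dP : is_derive x 1 (fun y : R => y ^- n) (- n%:R * x ^- n.+1).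
    rewrite [X in is_derive _ _ X _](_ : _ = (fun y : R => (y^-1))^+n); last first.
      by rewrite exprfctE; apply/funext => y; rewrite exprVn.
    apply: is_derive_eq (is_deriveX n dV) _.
    case: n => [|n]; first by rewrite mulr0n oppr0 !mul0r scale0r.
    rewrite /= scalerN mulNr /GRing.scale /= !exprVn; congr (- _).
    by rewrite -mulrA -invfM -exprD addn2.
  have D := is_deriveM dP dE.
  have E : {near x, (fun y : R => y ^- n) * (fun y : R => expR (- y^-1)) =1 flat n}.
    by near=> y; rewrite /flat ifT//; near: y; exact: lt_nbhsr.
  apply: is_derive_eq (near_eq_is_derive E D) _; rewrite /flat x0.
  rewrite /GRing.scale /= -!exprVn !exprS expr0; ring.
- rewrite !flat_le0// !mulr0 addr0.
  pose C : R := n.+2`!%:R.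
  have C0 : 0 < C by rewrite ltr0n fact_gt0.
  have lim0 : (fun h : R => h^-1 *: (flat n (h *: 1 + 0) - flat n 0)) @ 0^' --> (0:R).
    rewrite flat_le0//; apply/cvgrPdist_le => e e0.
    near=> h; rewrite sub0r normrN subr0 addr0 /GRing.scale /= mulr1.
    have hn0 : h != 0 by near: h; exact: nbhs_dnbhs_neq.
    rewrite normrM normfV ler_pdivrMl ?normr_gt0// ger0_norm ?flat_ge0//.
    apply: le_trans (flat_bound _ _) _; rewrite -/C -real_normK ?num_real//.
    rewrite expr2 mulrA mulrC ler_pM2l ?normr_gt0// -ler_pdivlMl//.
    near: h; apply: dnbhs0_le; rewrite mulr_gt0 ?invr_gt0//.
  apply: DeriveDef; first by apply/cvg_ex; exists 0.
  exact: cvg_lim lim0.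
Unshelve. all: by end_near. Qed.

Lemma smooth1_flat k n : smooth1 k (flat n).
Proof.
elim: k n => [|k IH] n.
  move=> x; apply/differentiable_continuous/derivable1_diffP.
  by case: (flat_derive n x).
exists (fun x => 1 * flat n.+2 x + - n%:R * flat n.+1 x); split.
  exact: flat_derive.
exact: smooth1_comb.
Qed.

(** The smooth substitute for max x 0. The factor x makes it convex on the whole
    line, which exp(-1/x) alone is not. *)
Definition hinge x : R := x * flat 0 x.

Lemma hinge_le0 x : x <= 0 -> hinge x = 0.
Proof. by move=> x0; rewrite /hinge flat_le0// mulr0. Qed.

Lemma hingeE x : 0 < x -> hinge x = x * expR (- x^-1).
Proof. by move=> x0; rewrite /hinge /flat x0 expr0 invr1 mul1r. Qed.

(** Its derivative is flat 0 + flat 1. *)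
Lemma smooth1_hinge k : smooth1 k hinge.
Proof.
apply: smooth1W; exists (fun x => 1 * flat 0 x + 1 * flat 1 x); split; last first.
  by apply: smooth1_comb; exact: smooth1_flat.
move=> x; have := is_deriveM (is_derive_id x 1) (flat_derive 0 x).
move=> h; apply: is_derive_eq h _; rewrite /GRing.scale /= oppr0 mul0r addr0 mul1r.
rewrite mul1r mulr1 addrC; congr (_ + _).
rewrite /flat; case: ifPn => x0; last by rewrite !mulr0.
have xn0 : x != 0 by rewrite gt_eqF.
by field.
Qed.

Lemma hinge_ge0 x : 0 <= hinge x.
Proof.
case: (leP x 0) => x0; first by rewrite hinge_le0.
by rewrite mulr_ge0 ?flat_ge0// ltW.
Qed.

(** Convexity and monotonicity of the hinge at once:
    for p > 0 the tangent at p is exp(-z) ((1 + z) x - 1) with z = 1/p, and it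
    stays below x exp(-1/x) because exp(z - 1/x) >= 1 + z - 1/x. *)
Lemma hinge_supp p : exists s, [/\ 0 <= s, s <= 1 &
  forall x, hinge p + s * (x - p) <= hinge x].
Proof.
case: (leP p 0) => p0.
  by exists 0; split => // x; rewrite mul0r addr0 hinge_le0// hinge_ge0.
have pn0 : p != 0 by rewrite gt_eqF.
have pi0 : 0 < p^-1 by rewrite invr_gt0.
have e0 := expR_gt0 (- p^-1).
exists (expR (- p^-1) * (1 + p^-1)); split.
- by rewrite mulr_ge0 ?expR_ge0// addr_ge0// ltW.
- by rewrite expRN mulrC ler_pdivrMr ?expR_gt0// mul1r expR_ge1Dx.
move=> x; rewrite (hingeE p0).
have -> : p * expR (- p^-1) + expR (- p^-1) * (1 + p^-1) * (x - p) =
   expR (- p^-1) * (x * (1 + p^-1) - 1) by field.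
case: (leP x 0) => x0.
  rewrite hinge_le0// pmulr_rle0//.
  have : x * (1 + p^-1) <= 0 by rewrite mulr_le0_ge0// addr_ge0// ltW.
  lra.
have xn0 : x != 0 by rewrite gt_eqF.
rewrite hingeE//.
have := expR_ge1Dx (p^-1 - x^-1); rewrite expRD => h.
have -> : x * expR (- x^-1) = expR (- p^-1) * (x * (expR p^-1 * expR (- x^-1))).
  by rewrite mulrCA [expR (- p^-1) * _]mulrA -expRD addNr expR0 mul1r.
rewrite ler_pM2l//; apply: le_trans (ler_wpM2l (ltW x0) h).
by rewrite le_eqVlt; apply/orP; left; apply/eqP; field; rewrite xn0 pn0.
Qed.

Lemma hinge_leid x : 0 <= x -> hinge x <= x.
Proof.
rewrite le_eqVlt => /orP[/eqP <-|x0]; first by rewrite hinge_le0.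
rewrite hingeE// ger_pMr// -expR0 ler_expR oppr_le0 invr_ge0; exact: ltW.
Qed.

Lemma hinge_geB1 x : x - 1 <= hinge x.
Proof.
case: (leP x 0) => x0; first by rewrite hinge_le0//; lra.
have xn0 : x != 0 by rewrite gt_eqF.
rewrite hingeE//; have := ler_wpM2l (ltW x0) (expR_ge1Dx (- x^-1)).
by rewrite mulrDr mulr1 mulrN divff.
Qed.

End FlatHinge.

(** * Functions of class C^k *)

Section Germs.
Context {R : realType} {V W : normedModType R}.

Lemma near_eq_differentiable (f g : V -> W) (x : V) :
  {near x, f =1 g} -> differentiable f x -> differentiable g x.
Proof.
move=> fg /diff_locallyP[cdf fE].
suff gE : g \o shift x = cst (g x) + 'd f x +o_ (0 : V) id.
  by apply/diff_locallyP; rewrite (diff_unique cdf gE).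
apply/eqaddoP => e e0.
have /eqaddoP fo : f \o shift x = cst (f x) + 'd f x +o_ (0 : V) id.
  by rewrite {1}fE.
have {}fo := fo e e0.
near=> h.
have -> : (g \o shift x - (cst (g x) + 'd f x)) h = (f \o shift x - (cst (f x) + 'd f x)) h.
  rewrite !fctE /= -(nbhs_singleton fg); congr (_ - _).
  by apply/esym; near: h; move: fg; rewrite (near_shift 0 x)/= subr0.
by near: h.
Unshelve. all: by end_near. Qed.

End Germs.

Section CkCalculus.
Context {R : realType} {d : nat}.
Implicit Types (f g u : 'rV[R]_d -> R) (k : nat) (U : set 'rV[R]_d).

Lemma continuous_CkT0 f : continuous f -> Ck 0 setT f.
Proof. exact: (continuous_subspace_setT f).1. Qed.

Lemma CkT_continuous k f : Ck k setT f -> continuous f.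
Proof.
case: k => [|k]; first exact: (continuous_subspace_setT f).2.
by move=> [df _] x; apply/differentiable_continuous/df.
Qed.

Lemma CkTW k f : Ck k.+1 setT f -> Ck k setT f.
Proof.
elim: k f => [|k IH] f fS.
  by apply: continuous_CkT0; exact: CkT_continuous fS.
by case: fS => df Df; split=> // v; apply: IH.
Qed.

Lemma Ck_cst k (a : R) : Ck k setT (cst a : 'rV[R]_d -> R).
Proof.
elim: k a => [|k IH] a; first by apply: continuous_CkT0; exact: cst_continuous.
split=> [x _|v]; first exact: differentiable_cst.
rewrite (_ : 'D_v _ = cst 0)//.
by apply/funext => x; rewrite derive_cst.
Qed.

Lemma scalar_continuous (l : {scalar 'rV[R]_d}) : continuous l.
Proof.
have -> : (l : _ -> R) = \sum_(i < d) (fun x : 'rV[R]_d => x ord0 i * l (delta_mx ord0 i)).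
  apply/funext => x; rewrite [in LHS](row_sum_delta x) linear_sum fct_sumE.
  by apply: eq_bigr => i _; rewrite linearZ.
move=> x; apply/differentiable_continuous/differentiable_sum => i.
by apply: differentiableM => //; exact: differentiable_coord.
Qed.

Lemma Ck_scalar k (l : {scalar 'rV[R]_d}) : Ck k setT l.
Proof.
case: k => [|k]; first by apply: continuous_CkT0; exact: scalar_continuous.
split=> [x _|v]; first by apply: linear_differentiable; exact: scalar_continuous.
rewrite (_ : 'D_v _ = cst (l v)); first exact: Ck_cst.
apply/funext => x; rewrite deriveE; last by apply: linear_differentiable; exact: scalar_continuous.
by rewrite diff_lin//; exact: scalar_continuous.
Qed.

Lemma CkD k f g : Ck k setT f -> Ck k setT g -> Ck k setT (f \+ g).
Proof.
elim: k f g => [|k IH] f g.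
  move=> /CkT_continuous cf /CkT_continuous cg.
  by apply: continuous_CkT0 => x; exact: (continuousD (cf x) (cg x)).
move=> [df Df] [dg Dg]; split=> [x _|v]; first by apply: differentiableD; [exact: df|exact: dg].
rewrite (_ : 'D_v _ = 'D_v f \+ 'D_v g); first by apply: IH; [exact: Df|exact: Dg].
apply/funext => x; apply: deriveD; apply: diff_derivable; [exact: df|exact: dg].
Qed.

Lemma CkM k f g : Ck k setT f -> Ck k setT g -> Ck k setT (f \* g).
Proof.
elim: k f g => [|k IH] f g fk gk.
  move: fk gk => /CkT_continuous cf /CkT_continuous cg.
  by apply: continuous_CkT0 => x; exact: (continuousM (cf x) (cg x)).
have [df Df] := fk; have [dg Dg] := gk.
split=> [x _|v]; first by apply: differentiableM; [exact: df|exact: dg].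
rewrite (_ : 'D_v _ = (f \* 'D_v g) \+ (g \* 'D_v f)).
  by apply: CkD; apply: IH; [exact: CkTW|exact: Dg|exact: CkTW|exact: Df].
apply/funext => x; rewrite /GRing.mul_fun /=.
by rewrite -[RHS]/(f x *: 'D_v g x + g x *: 'D_v f x); apply: deriveM;
  apply: diff_derivable; [exact: df|exact: dg].
Qed.

Lemma Ck_comp1 k (phi : R -> R) u :
  smooth1 k phi -> Ck k setT u -> Ck k setT (phi \o u).
Proof.
elim: k phi u => [|k IH] phi u sphi uk.
  apply: continuous_CkT0 => x; apply: continuous_comp.
    exact: (CkT_continuous uk).
  exact: sphi.
have [psi [dphi spsi]] := sphi; have [du Du] := uk.
have dp y : differentiable phi y by apply/derivable1_diffP; case: (dphi y).
have dc x : differentiable (phi \o u) x.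
  by apply: differentiable_comp => //; exact: du.
split=> [x _|v]; first exact: dc.
rewrite (_ : 'D_v _ = (psi \o u) \* 'D_v u).
  by apply: CkM; [apply: IH spsi _; exact: CkTW|exact: Du].
apply/funext => x; rewrite deriveE// diff_comp//; last exact: du.
rewrite /= (deriveE v (du x I)); have [dpx dpE] := dphi (u x).
by rewrite deriv1E// derive1E dpE mulrC.
Qed.

(** The class C^k depends only on germs, so that a function on U assembled from
    globally smooth pieces is smooth on U. *)
Lemma Ck_local k U f :
  (forall x, U x -> exists2 u, Ck k setT u & {near x, u =1 f}) -> Ck k U f.
Proof.
elim: k f => [|k IH] f loc.
  apply: continuous_in_subspaceT => x /set_mem Ux.
  have [u uk uf] := loc x Ux.
  have cu := CkT_continuous uk.
  rewrite /continuous_at -(nbhs_singleton uf).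
  exact: cvg_trans (near_eq_cvg uf) (cu x).
split=> [x Ux|v].
  have [u [du _] uf] := loc x Ux.
  exact: near_eq_differentiable uf (du x I).
apply: IH => x Ux; have [u [_ Du] uf] := loc x Ux; exists ('D_v u); first exact: Du.
by apply: filterS (near_join uf) => y; exact: near_eq_derive.
Qed.

End CkCalculus.

(** * Convex functions and the smoothed maximum *)

Section Convexity.
Context {R : realType} {V : lmodType R}.
Implicit Types (U : set V) (f : V -> R).

Lemma convex_setP U : convex_set U <-> forall x y (t : R), U x -> U y ->
  0 <= t <= 1 -> U (t *: x + (1 - t) *: y).
Proof.
split=> [cU x y t Ux Uy /andP[t0 t1]|cU x y t /set_mem Ux /set_mem Uy].
  exact: set_mem (cU x y (Itv01 t0 t1) (mem_set Ux) (mem_set Uy)).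
by apply/mem_set; apply: cU => //; apply/andP; split.
Qed.

Lemma convex_functionP U f : convex_function U f <->
  forall x y (t : R), U x -> U y -> 0 <= t <= 1 ->
  f (t *: x + (1 - t) *: y) <= t * f x + (1 - t) * f y.
Proof.
split=> [cf x y t Ux Uy /andP[t0 t1]|cf t x y /set_mem Ux /set_mem Uy].
  exact: cf (Itv01 t0 t1) x y (mem_set Ux) (mem_set Uy).
by apply: cf => //; apply/andP; split.
Qed.

Lemma convex_function_scalarD U (l : {scalar V}) f : convex_function U f ->
  convex_function U (fun x => l x + f x).
Proof.
move=> /convex_functionP cf; apply/convex_functionP => x y t Ux Uy t01.
rewrite linearD !linearZ /=; have := cf x y t Ux Uy t01; lra.
Qed.

End Convexity.

Section TangentPlanes.
Context {R : realType} {V : normedModType R}.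
Implicit Types (U : set V) (f : V -> R).

(** The difference quotients of f along the segment from x to y are at most
    f y - f x by convexity, and 'd f x (y - x) is their limit. *)
Lemma convex_above_tangent U f (x y : V) : convex_function U f ->
  U x -> U y -> differentiable f x -> f x + 'd f x (y - x) <= f y.
Proof.
move=> /convex_functionP cf Ux Uy df; rewrite -lerBrDl -deriveE//.
have dv : derivable f x (y - x) by exact: diff_derivable.
have cv := cvg_dnbhs_at_right dv.
rewrite (_ : 'D_(y - x) f x = lim (h^-1 *: (f (h *: (y - x) + x) - f x) @[h --> 0^'+])).
  apply: limr_le; first by apply/cvg_ex; eexists; exact: cv.
  near=> h.
  have h0 : 0 < h by near: h; exact: nbhs_right_gt.
  have h1 : h <= 1 by near: h; exact: nbhs_right_le.
  rewrite /GRing.scale /= ler_pdivrMl//.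
  have -> : h *: (y - x) + x = h *: y + (1 - h) *: x.
    by rewrite scalerBr scalerBl scale1r -addrA [_ + x]addrC.
  have := cf y x h Uy Ux; rewrite (ltW h0) h1 => /(_ isT); lra.
by apply/esym; apply: cvg_lim.
Unshelve. all: by end_near. Qed.

End TangentPlanes.

Section SmoothMax.
Context {R : realType} {d : nat}.
Local Notation E := 'rV[R]_d.
Implicit Types (g u v : E -> R).

Definition smooth_convex g := convex_function setT g /\ Cinfty setT g.

(** Being equal to u wherever v <= u is what makes infinitely many successive
    gluings locally stationary. *)
Definition smax (e : R) u v : E -> R := fun x => u x + e * hinge ((v x - u x) / e).

(** A supporting line of slope s in [0, 1] of the hinge bounds smax from below by
    (1 - s) u + s v + constant, with equality at the chosen point; as s and 1 - s
    are nonnegative, this minorant is convex. *)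
Lemma smooth_convex_smax e u v : 0 < e ->
  smooth_convex u -> smooth_convex v -> smooth_convex (smax e u v).
Proof.
move=> e0 [/convex_functionP cu Cu] [/convex_functionP cv Cv]; split; last first.
  move=> k; apply: CkD; first exact: Cu.
  rewrite [X in Ck _ _ X](_ : _ = cst e \* (hinge \o (cst e^-1 \* (v \+ (cst (-1) \* u))))).
    apply: CkM; first exact: Ck_cst.
    apply: Ck_comp1; first exact: smooth1_hinge.
    apply: CkM; first exact: Ck_cst.
    apply: CkD; first exact: Cv.
    by apply: CkM; [exact: Ck_cst|exact: Cu].
  by apply/funext => x; rewrite /= mulN1r [e^-1 * _]mulrC.
apply/convex_functionP => x y t _ _ t01.
rewrite /smax; set z := t *: x + _.
have := cu x y t I I t01; have := cv x y t I I t01; rewrite -/z => cvz cuz.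
have [s [s0 s1 hs]] := hinge_supp ((v z - u z) / e).
(* the minorant given by the supporting line at z, evaluated at w *)
have H w : (1 - s) * u w + s * v w + (e * hinge ((v z - u z) / e) - s * (v z - u z))
    <= u w + e * hinge ((v w - u w) / e).
  have := ler_wpM2l (ltW e0) (hs ((v w - u w) / e)).
  rewrite mulrDr -mulrBl; set a := hinge _; set b := hinge _.
  have -> : e * (s * ((v w - u w - (v z - u z)) / e)) = s * (v w - u w - (v z - u z)).
    by field; rewrite gt_eqF.
  lra.
have /andP[t0 t1] := t01; have t1' : 0 <= 1 - t by lra.
have s1' : 0 <= 1 - s by lra.
have := ler_wpM2l t0 (H x); have := ler_wpM2l t1' (H y).
have := ler_wpM2l s1' cuz; have := ler_wpM2l s0 cvz.
set a := hinge _; set b := hinge _; set c := hinge _.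
nra.
Qed.

Lemma smax_gel e u v x : 0 < e -> u x <= smax e u v x.
Proof. by move=> e0; rewrite lerDl mulr_ge0 ?hinge_ge0// ltW. Qed.

Lemma smax_ger e u v x : 0 < e -> v x - e <= smax e u v x.
Proof.
move=> e0; have := ler_wpM2l (ltW e0) (hinge_geB1 ((v x - u x) / e)).
rewrite mulrBr mulr1 [e * (_ / e)]mulrC divfK ?gt_eqF// /smax; lra.
Qed.

Lemma smax_le e u v x b : 0 < e -> u x <= b -> v x <= b -> smax e u v x <= b.
Proof.
move=> e0 ub vb; rewrite /smax; case: (leP (v x) (u x)) => uv.
  rewrite hinge_le0 ?mulr0 ?addr0//.
  by rewrite mulr_le0_ge0 ?invr_ge0 ?subr_le0// ltW.
have vu0 : 0 <= (v x - u x) / e by rewrite divr_ge0 ?subr_ge0 ?ltW.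
have := ler_wpM2l (ltW e0) (hinge_leid vu0).
rewrite [e * (_ / e)]mulrC divfK ?gt_eqF//; lra.
Qed.

(** The successive losses do not add up: each gluing loses at most e against the
    function glued in, and later ones only increase the result. *)
Lemma smax_fold (I : eqType) (s : seq I) (L : I -> E -> R) g e : 0 < e ->
  smooth_convex g -> (forall i, i \in s -> smooth_convex (L i)) ->
  exists h, [/\ smooth_convex h, (forall x, g x <= h x),
    (forall x b, g x <= b -> (forall i, i \in s -> L i x <= b) -> h x <= b) &
    (forall i x, i \in s -> L i x - e <= h x)].
Proof.
move=> e0; elim: s g => [|i s IH] g cg cL; first by exists g; split.
have ci : smooth_convex (L i) by apply: cL; rewrite mem_head.
have [||h [ch gh hb hL]] := IH (smax e g (L i)).
- exact: smooth_convex_smax.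
- by move=> j js; apply: cL; rewrite inE js orbT.
exists h; split=> //.
- by move=> x; apply: le_trans (gh x); exact: smax_gel.
- move=> x b gb Lb; apply: hb => [|j js]; last by apply: Lb; rewrite inE js orbT.
  by apply: smax_le => //; apply: Lb; rewrite mem_head.
- move=> j x; rewrite inE => /orP[/eqP ->|]; last exact: hL.
  by apply: le_trans (gh x); exact: smax_ger.
Qed.

Lemma smooth_convex_cst (a : R) : smooth_convex (cst a).
Proof.
split=> [|k]; last exact: Ck_cst.
apply/convex_functionP => x y t _ _ _ /=; lra.
Qed.

Definition tangent (f : E -> R) (p : E) : E -> R := fun x => f p + 'd f p (x - p).

Lemma smooth_convex_tangent f p : differentiable f p -> smooth_convex (tangent f p).
Proof.
move=> df.
have tE : tangent f p = 'd f p \+ cst (f p - 'd f p p).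
  by apply/funext => x; rewrite /tangent linearB addrA addrAC addrC.
rewrite tE; split; last by move=> k; apply: CkD; [exact: Ck_scalar|exact: Ck_cst].
exact: convex_function_scalarD (smooth_convex_cst _).1.
Qed.

(** The tangent planes of psi are everywhere below psi, and each is within e / 2
    of psi near its point of contact; finitely many of these neighbourhoods
    cover K. *)
Lemma patch_tangents (U K : set E) (psi g : E -> R) (e : R) :
  0 < e -> open U -> convex_function U psi -> (forall x, U x -> differentiable psi x) ->
  compact K -> K `<=` U -> smooth_convex g ->
  exists h, [/\ smooth_convex h, (forall x, g x <= h x),
    (forall x b, U x -> g x <= b -> psi x <= b -> h x <= b) &
    (forall x, K x -> psi x - e <= h x)].
Proof.
move=> e0 oU cpsi dpsi cK KU sg.
have e20 : 0 < e / 2 by rewrite divr_gt0.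
pose N p := [set x | U x /\ psi x - tangent psi p x < e / 2]°.
have [s sU sK] : exists2 s : seq E, (forall p, p \in s -> U p) &
    forall x, K x -> exists2 p, p \in s & N p x.
  move: cK; rewrite compact_cover => /(_ _ U N).
  have oN p : U p -> open (N p) by move=> _; exact: open_interior.
  move=> /(_ oN)[|D DU KD].
    move=> x Kx; exists x; first exact: KU.
    have Ux := KU _ Kx.
    have ct : {for x, continuous (fun y => psi y - tangent psi x y)}.
      apply: continuousB; first exact/differentiable_continuous/dpsi.
      have [_ Ct] := smooth_convex_tangent (dpsi x Ux).
      exact: (CkT_continuous (Ct 0)).
    rewrite /N /interior /=; apply: filterI; first exact: open_nbhs_nbhs.
    apply: (cvgr_lt _ ct).
    by rewrite /tangent subrr linear0 addr0 subrr.
  by exists (finmap.enum_fset D) => [p /DU /set_mem|x /KD[p pD Np]] //; exists p.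
have [|h [sh gh hb hL]] := @smax_fold _ s (tangent psi) g (e / 2) e20 sg.
  by move=> p /sU Up; apply: smooth_convex_tangent; exact: dpsi.
exists h; split=> //.
- move=> x b Ux gb pb; apply: hb => // p /sU Up; apply: le_trans pb.
  exact: convex_above_tangent (dpsi _ Up).
- move=> x /sK[p ps /interior_subset[Ux]].
  by have := hL p x ps; lra.
Qed.

End SmoothMax.

(** * Uniform closeness controls the derivative *)

(** One-variable core of the comparison of derivatives: y is the point
    x + s v, while Fx, Fy are the slopes of f at x and y along v, and G is the
    slope of g at x. The number F0, a slope of f at a nearby reference point,
    measures the oscillation of the slope. *)
Lemma slope_estimate {R : realType} (s m e Fx Fy F0 G fx fy gx gy : R) :
  0 < s -> e <= s * m / 4 -> gx + s * G <= gy -> fy - s * Fy <= fx ->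
  `|fx - gx| <= e -> `|fy - gy| <= e -> `|Fx - F0| <= m / 4 -> `|Fy - F0| <= m / 4 ->
  G - Fx <= m.
Proof.
move=> s0 em gxy fxy.
rewrite !ler_norml => /andP[_ fgx] /andP[fgy _] /andP[FxF0 _] /andP[_ FyF0].
rewrite -(ler_pM2l s0) mulrBr.
have : s * (Fy - Fx) <= s * (m / 2) by rewrite ler_pM2l//; lra.
rewrite mulrBr; lra.
Qed.

Section DerivativeControl.
Context {R : realType} {d : nat}.
Local Notation E := 'rV[R]_d.
Implicit Types (f g : E -> R) (U V K : set E).

Lemma near_open_in U x : open U -> U x -> \forall y \near x, U y.
Proof. by move=> oU Ux; exact: open_nbhs_nbhs. Qed.

(** In finite dimension the continuity of the partial derivatives makes the
    differential continuous uniformly over the directions of the unit cube. *)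
Lemma Ck1_near_diff U f (x : E) (e : R) : open U -> Ck 1 U f -> U x -> 0 < e ->
  \forall y \near x, forall v : E, (forall i, `|v ord0 i| <= 1) ->
    `|'d f y v - 'd f x v| <= e.
Proof.
move=> oU [df Df] Ux e0.
have ed0 : 0 < e / d.+1%:R by rewrite divr_gt0.
have cD (i : 'I_d) : \forall y \near x,
    `|'D_(delta_mx ord0 i) f x - 'D_(delta_mx ord0 i) f y| <= e / d.+1%:R.
  have := Df (delta_mx ord0 i); rewrite /= continuous_open_subspace// => /(_ x (mem_set Ux)).
  by move=> /cvgrPdist_le; apply.
near=> y => v v1.
have Uy : U y by near: y; exact: near_open_in.
have dE z : U z -> 'd f z v = \sum_(i < d) v ord0 i * 'D_(delta_mx ord0 i) f z.
  move=> Uz; rewrite [in LHS](row_sum_delta v) linear_sum.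
  by apply: eq_bigr => i _; rewrite linearZ/= deriveE//; exact: df.
have Ey := dE y Uy.
have Ex := dE x Ux.
have Exy : 'd f y v - 'd f x v = \sum_(i < d) v ord0 i *
    ('D_(delta_mx ord0 i) f y - 'D_(delta_mx ord0 i) f x) :> R.
  rewrite [X in X - _]Ey.
  rewrite [X in _ - X]Ex.
  under [RHS]eq_bigr do rewrite mulrBr.
  by rewrite sumrB.
rewrite Exy.
apply: le_trans (ler_norm_sum _ _ _) _.
apply: (@le_trans _ _ (\sum_(i < d) e / d.+1%:R)).
  apply: ler_sum => i _; rewrite normrM -[leRHS]mul1r.
  apply: ler_pM => //; rewrite distrC; move: i; near: y.
  exact: filter_forall.
rewrite sumr_const card_ord -[_ *+ d]mulr_natr mulrAC ler_pdivrMr// ler_pM2l//.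
by rewrite ler_nat.
Unshelve. all: by end_near. Qed.

(** The set V leaves room for the difference quotients based at points of K. The
    local statement is proved with a step r depending on the base point, and
    compactness of K makes e uniform. *)
Lemma uniform_C1_control U V K f (eps : E -> R) :
  open U -> convex_function U f -> Ck 1 U f ->
  {within U, continuous eps} -> (forall x, U x -> 0 < eps x) ->
  open V -> V `<=` U -> compact K -> K `<=` V ->
  exists2 e, 0 < e & forall g, convex_function U g ->
    (forall x, U x -> differentiable g x) ->
    (forall x, V x -> `|f x - g x| <= e) ->
    forall x, K x -> `|f x - g x| <= eps x /\
      forall v : E, (forall i, `|v ord0 i| <= 1) -> `|'d f x v - 'd g x v| <= eps x.
Proof.
move=> oU cf C1f ceps eps0 oV VU cK KV.
have [df _] := C1f.
pose P (e : R) (x : E) := forall g, convex_function U g ->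
    (forall x, U x -> differentiable g x) ->
    (forall x, V x -> `|f x - g x| <= e) ->
    `|f x - g x| <= eps x /\
      forall v : E, (forall i, `|v ord0 i| <= 1) -> `|'d f x v - 'd g x v| <= eps x.
suff H x0 : K x0 -> \forall x \near x0 & e \near 0^'+, P e x.
  have /compact_near_coveringP /(_ R (0^'+) P _ H) KP := cK.
  near (0 : R)^'+ => e; exists e; first by near: e; exact: nbhs_right_gt.
  move=> g cg dg fg x Kx.
  have : K `<=` P e by near: e.
  by move=> /(_ x Kx g cg dg fg).
move=> Kx0; have Vx0 := KV _ Kx0; have Ux0 := VU _ Vx0.
have m0 : 0 < eps x0 / 2 by rewrite divr_gt0// eps0.
set m := eps x0 / 2 in m0.
have [r /= r0 Hr] : exists2 r : R, 0 < r & forall y, ball x0 (r + r) y ->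
    [/\ V y, m <= eps y & forall v : E, (forall i, `|v ord0 i| <= 1) ->
    `|'d f y v - 'd f x0 v| <= m / 4].
  have N : \forall y \near x0, [/\ V y, m <= eps y &
      forall v : E, (forall i, `|v ord0 i| <= 1) -> `|'d f y v - 'd f x0 v| <= m / 4].
    near=> y; split.
    - by near: y; exact: near_open_in.
    - near: y; have := ceps; rewrite continuous_open_subspace// => /(_ x0 (mem_set Ux0)).
      by move=> /cvgr_ge; apply; rewrite /m; have := eps0 _ Ux0; lra.
    - by near: y; apply: Ck1_near_diff oU C1f Ux0 _; rewrite divr_gt0.
  have /nbhs_ballP[r /= r0 Hr] := N.
  exists (r / 2); first by rewrite divr_gt0.
  by move=> y; rewrite -splitr; exact: Hr.
exists (ball x0 r, [set e | 0 < e <= Num.min m (r * m / 8)]) => /=.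
  split; first exact: nbhsx_ballx.
  have mm0 : 0 < Num.min m (r * m / 8) by rewrite lt_min m0 divr_gt0// mulr_gt0.
  near=> e; apply/andP; split; near: e; [exact: nbhs_right_gt|exact: nbhs_right_le].
move=> [x e] /= [xx0 /andP[e0]]; rewrite le_min => /andP[em er] g cg dg fg.
have ball2 y : ball x r y -> ball x0 (r + r) y by exact: ball_triangle.
have [Vx mx dx] := Hr _ (ball2 _ (ballxx _ r0)).
split; first exact: le_trans (fg x Vx) (le_trans em mx).
have Ux := VU _ Vx.
(* the upper bound suffices, since it also applies to the opposite direction *)
have half (v : E) : (forall i, `|v ord0 i| <= 1) -> 'd g x v - 'd f x v <= m.
  move=> v1.
  (* half of r, so that x + s v is in the open ball of radius r *)
  pose s := r / 2; have s0 : 0 < s by rewrite divr_gt0.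
  pose y := x + s *: v.
  have yx : ball x r y.
    split=> // i j; rewrite (ord1 i) /ball /= /y !mxE opprD addNKr normrN normrM gtr0_norm//.
    apply: (@le_lt_trans _ _ s); first by rewrite ger_pMr.
    by rewrite /s; lra.
  have [Vy _ dy] := Hr _ (ball2 _ yx); have Uy := VU _ Vy.
  have lin (l : {scalar E}) : l (s *: v) = s * l v by rewrite linearZ.
  have linN (l : {scalar E}) : l (- (s *: v)) = - (s * l v) by rewrite linearN linearZ.
  have yBx : y - x = s *: v by rewrite /y addrAC subrr add0r.
  have xBy : x - y = - (s *: v) by rewrite -yBx opprB.
  have gxy : g x + s * 'd g x v <= g y.
    by have := convex_above_tangent cg Ux Uy (dg _ Ux); rewrite yBx [X in _ + X]lin.
  have fxy : f y - s * 'd f y v <= f x.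
    by have := convex_above_tangent cf Uy Ux (df _ Uy); rewrite xBy [X in _ + X]linN.
  have s8 : e <= s * m / 4 by rewrite (_ : s * m / 4 = r * m / 8)// /s; field.
  exact: slope_estimate s0 s8 gxy fxy (fg _ Vx) (fg _ Vy) (dx v v1) (dy v v1).
move=> v v1; apply: le_trans mx; rewrite ler_norml; apply/andP; split.
  by rewrite lerNl opprB; exact: half.
have : 'd g x (- v) - 'd f x (- v) <= m by apply: half => i; rewrite mxE normrN.
have lN (l : {scalar E}) : l (- v) = - l v by rewrite linearN.
by rewrite [X in X - _]lN [X in _ - X]lN opprK addrC.
Unshelve. all: by end_near. Qed.

End DerivativeControl.

(** * Approximation in the fine C^0 topology *)

(** Slopes s_n for which the lines r |-> r + s_n (t_{n+1} - r) are ordered: on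
    r <= t_n the next line lies strictly below, by at least gap_n. It is enough
    that s decrease and that this hold at r = t_n, where t_{n+1} - t_n > 0 leaves
    room for it. Where such a line exceeds the identity above t_0, it does so by
    at most s_n (t_{n+1} - t_0), which is kept below all the e_k with k <= n. *)
Lemma convex_gap_sequences {R : realType} (t e : nat -> R) :
  (forall n, t n < t n.+1) -> (forall n, 0 < e n) ->
  exists s gap : nat -> R, [/\ forall n, 0 <= s n <= 1,
    forall n, 0 < gap n,
    forall n k, (k <= n)%N -> gap n <= e k,
    forall n k, (k <= n)%N -> s n * (t n.+1 - t 0%N) <= e k &
    forall n r, r <= t n -> s n.+1 * (t n.+2 - r) <= s n * (t n.+1 - r) - gap n].
Proof.
move=> tS e0.
(* running minimum of e *)
have [e' [e'0 e'le]] : exists e' : nat -> R, (forall n, 0 < e' n) /\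
    forall n k, (k <= n)%N -> e' n <= e k.
  exists (fix e' n := if n is m.+1 then Num.min (e' m) (e m.+1) else e 0%N).
  split; first by elim=> [|n IH] //=; rewrite lt_min IH e0.
  elim=> [|n IH] k; first by rewrite leqn0 => /eqP ->.
  rewrite leq_eqVlt => /orP[/eqP -> |kn]; first by rewrite ge_min lexx orbT.
  by rewrite ge_min IH.
have tlt n m : (n < m)%N -> t n < t m by move: n m; exact: homo_ltn lt_trans tS.
have t0 n : 0 < t n.+1 - t 0%N by rewrite subr_gt0 tlt.
have t1 n : 0 < t n.+1 - t n by rewrite subr_gt0.
have t2 n : 0 < t n.+2 - t n by rewrite subr_gt0 tlt.
pose s := fix s n := if n is m.+1 then
   Num.min (Num.min (s m) (e' n / (t n.+1 - t 0%N)))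
     (s m * (t n - t m) / (2 * (t n.+1 - t m)))
   else Num.min 1 (e' 0%N / (t 1%N - t 0%N)).
have s0 n : 0 < s n.
  elim: n => [|n IH] /=; rewrite !lt_min ?ltr01 ?IH /=.
    by rewrite divr_gt0.
  by rewrite !divr_gt0 ?mulr_gt0.
have sS n : s n.+1 <= s n by rewrite /= !ge_min lexx.
have sgap n : s n.+1 * (t n.+2 - t n) < s n * (t n.+1 - t n).
  have h : s n.+1 <= s n * (t n.+1 - t n) / (2 * (t n.+2 - t n)).
    by rewrite [s n.+1]/= !ge_min lexx !orbT.
  have {}h : s n.+1 * (2 * (t n.+2 - t n)) <= s n * (t n.+1 - t n).
    by rewrite -ler_pdivlMr// mulr_gt0.
  have := mulr_gt0 (s0 n.+1) (t2 n); lra.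
exists s, (fun n => Num.min (e' n) (s n * (t n.+1 - t n) - s n.+1 * (t n.+2 - t n))).
split.
- move=> n; rewrite (ltW (s0 n)) /=.
  elim: n => [|n IH]; first by rewrite /= ge_min lexx.
  exact: le_trans (sS n) IH.
- by move=> n; rewrite lt_min e'0 subr_gt0 sgap.
- by move=> n k kn; rewrite ge_min e'le.
- move=> n k /e'le; apply: le_trans; rewrite -ler_pdivlMr//.
  by case: n => [|n] /=; rewrite !ge_min lexx ?orbT.
- move=> n r rt.
  have : Num.min (e' n) (s n * (t n.+1 - t n) - s n.+1 * (t n.+2 - t n)) <=
    s n * (t n.+1 - t n) - s n.+1 * (t n.+2 - t n) by rewrite ge_min lexx orbT.
  have : 0 <= (s n - s n.+1) * (t n - r) by rewrite mulr_ge0 ?subr_ge0.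
  set a := Num.min _ _; set b := s n; set c := s n.+1; lra.
Qed.

(** Convexity and closeness pass to the limit because on each sublevel set
    {c <= t_n} the limit is the approximant obtained at step n. The start is the
    constant t_0, which is below c and hence compatible with every upper bound. *)
Lemma fine_convex_approx {R : realType} {d : nat} (U : set 'rV[R]_d)
    (c : 'rV[R]_d -> R) (t e : nat -> R) :
  open U -> convex_set U -> convex_function U c ->
  (forall x, U x -> differentiable c x) ->
  (forall n, t n < t n.+1) -> (forall x, U x -> t 0%N <= c x) ->
  (forall x, U x -> exists n, c x < t n) ->
  (forall n, compact (U `&` [set x | c x <= t n])) ->
  (forall n, 0 < e n) ->
  exists g, [/\ convex_function U g,
    forall x, U x -> exists2 u, smooth_convex u & {near x, u =1 g} &
    forall k x, U x -> t k < c x -> `|c x - g x| <= e k].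
Proof.
move=> oU /convex_setP cU cc dc tS tc tn cK e0.
have [s [gap [s01 gap0 gape se sgap]]] := convex_gap_sequences tS e0.
have tlt n m : (n < m)%N -> t n < t m by move: n m; exact: homo_ltn lt_trans tS.
have tle n m : (n <= m)%N -> t n <= t m.
  by rewrite leq_eqVlt => /orP[/eqP->//|/tlt/ltW].
pose K n := U `&` [set x | c x <= t n].
pose psi n x := c x + s n * (t n.+1 - c x).
have cpsi n : convex_function U (psi n).
  move/convex_functionP : cc => cc; apply/convex_functionP => x y q Ux Uy q01.
  have := cc x y q Ux Uy q01; have /andP[_ s1] := s01 n.
  rewrite /psi; set z := q *: x + _ => h.
  have {}h : (1 - s n) * c z <= (1 - s n) * (q * c x + (1 - q) * c y).
    by rewrite ler_wpM2l// subr_ge0.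
  lra.
have dpsi n x : U x -> differentiable (psi n) x.
  move=> Ux; rewrite (_ : psi n = (fun=> s n * t n.+1) + (1 - s n) *: c).
    by apply: differentiableD; [exact: differentiable_cst|apply: differentiableZ; exact: dc].
  by apply/funext => y; rewrite /psi !fctE /GRing.scale /=; lra.
(* the smoothness premise is inside the existential, so that choice applies *)
have step (nh : nat * ('rV[R]_d -> R)) : exists h, smooth_convex nh.2 ->
   [/\ smooth_convex h, (forall x, nh.2 x <= h x),
    (forall x b, U x -> nh.2 x <= b -> psi nh.1 x <= b -> h x <= b) &
    (forall x, K nh.1 x -> psi nh.1 x - gap nh.1 <= h x)].
  case: nh => n g /=.
  have [sg|nsg] := pselect (smooth_convex g); last by exists g.
  have [h Hh] := patch_tangents (gap0 n) oU (cpsi n) (dpsi n) (cK n) (@subIsetl _ _ _) sg.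
  by exists h.
have [F HF] := choice step.
pose G := fix G n := if n is m.+1 then F (m, G m) else (cst (t 0%N) : 'rV[R]_d -> R).
have sG n : smooth_convex (G n).
  elim: n => [|n IH]; first exact: smooth_convex_cst.
  by have [] := HF (n, G n) IH.
have Gup n x : G n x <= G n.+1 x by have [_ + _ _] := HF (n, G n) (sG n); exact.
have Gmax n x b : U x -> G n x <= b -> psi n x <= b -> G n.+1 x <= b.
  by have [_ _ + _] := HF (n, G n) (sG n); exact.
have Glow n x : K n x -> psi n x - gap n <= G n.+1 x.
  by have [_ _ _] := HF (n, G n) (sG n); exact.
(* psi_m is below the approximant already reached on {c <= t_n} *)
have Gstat n m x : K n x -> (n < m)%N -> G m x = G n.+1 x.
  move=> [Ux cx]; elim: m => // m IH; rewrite ltnS leq_eqVlt => /orP[/eqP -> //|nm].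
  rewrite -(IH nm); apply/eqP; rewrite eq_le Gup andbT.
  apply: Gmax => //.
  case: m nm {IH} => // m nm.
  have cm : c x <= t m by apply: le_trans cx _; exact: tle.
  apply: le_trans (Glow m x (conj Ux cm)); rewrite /psi -addrA lerD2l; exact: sgap.
have level x : exists n, U x -> c x < t n.
  by have [/tn[n cx]|nUx] := pselect (U x); [exists n|exists 0%N].
have [N HN] := choice level.
pose g x := G (N x).+1 x.
have gE n x : U x -> c x <= t n -> g x = G n.+1 x.
  move=> Ux cx; have cNx : K (N x) x by split=> //; exact: ltW (HN _ Ux).
  pose m := (maxn n (N x)).+1.
  rewrite /g -(@Gstat (N x) m)// ?ltnS ?leq_maxr//.
  by rewrite -(@Gstat n m)// ltnS leq_maxl.
exists g; split.
- apply/convex_functionP => x y q Ux Uy q01.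
  have Uz := cU x y q Ux Uy q01; set z := _ + _ in Uz *.
  pose m := (N x + N y + N z)%N.
  have cm w : U w -> (N w <= m)%N -> g w = G m.+1 w.
    by move=> Uw wm; apply: gE => //; apply: le_trans (ltW (HN _ Uw)) _; exact: tle.
  have Nx : (N x <= m)%N by rewrite /m -addnA leq_addr.
  have Ny : (N y <= m)%N by rewrite /m addnAC leq_addl.
  have Nz : (N z <= m)%N by rewrite /m leq_addl.
  rewrite (cm x)// (cm y)// (cm z)//.
  by have [/convex_functionP cG _] := sG m.+1; exact: cG.
- move=> x Ux; exists (G (N x).+1); first exact: sG.
  near=> y; apply/esym/gE; first by near: y; exact: near_open_in.
  apply: ltW; near: y.
  have /differentiable_continuous/cvgr_lt := dc x Ux; apply; exact: HN.
- move=> k x Ux kx; rewrite distrC ler_norml; apply/andP; split.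
    have cx := HN x Ux; rewrite (gE (N x) x Ux (ltW cx)).
    have kN : (k <= N x)%N.
      by rewrite leqNgt; apply/negP => /ltnW/tle; rewrite leNgt (lt_trans kx cx).
    have cs : 0 <= s (N x) * (t (N x).+1 - c x).
      have /andP[? _] := s01 (N x); rewrite mulr_ge0// subr_ge0.
      by apply: ltW; exact: lt_trans cx (tS _).
    rewrite lerBrDr addrC; apply: le_trans (Glow (N x) x (conj Ux (ltW cx))).
    rewrite /psi -addrA lerD2l; apply: le_trans (_ : - gap (N x) <= _); last by rewrite lerDr.
    by rewrite lerN2 gape.
  suff H n : G n x <= c x + e k by rewrite lerBlDl; exact: H.
  elim: n => [|n IH].
    by rewrite /=; apply: le_trans (tc x Ux) _; rewrite lerDl ltW.
  apply: Gmax => //; rewrite /psi lerD2l.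
  have /andP[sn0 _] := s01 n.
  have [tx|xt] := leP (t n.+1) (c x).
    by apply: le_trans (ltW (e0 k)); rewrite mulr_ge0_le0// subr_le0.
  have kn : (k <= n)%N.
    by rewrite leqNgt; apply/negP => /tle; rewrite leNgt (lt_trans kx xt).
  by apply: le_trans (se _ _ kn); rewrite ler_wpM2l// lerD2l lerN2 tc.
Unshelve. all: by end_near. Qed.

(** The first two levels are below a, so that every point at which c >= a lies
    between two consecutive levels t_{n+1} and t_{n+2}. *)
Lemma exhausting_levels {R : realType} (a : R) (b : \bar R) : (a%:E < b)%E ->
  exists t : nat -> R, [/\ forall n, t n < t n.+1, t 1%N < a,
    forall n, ((t n)%:E < b)%E & forall r, (r%:E < b)%E -> exists n, r < t n].
Proof.
case: b => [b| |]//; last first.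
  move=> _; exists (fun n => a - 2 + n%:R); split.
  - by move=> n; rewrite ltrD2l ltr_nat.
  - lra.
  - by move=> n; rewrite ltry.
  - move=> r _; have [n rn] : exists n : nat, r - (a - 2) < n%:R.
      by exists (Num.truncn `|r - (a - 2)|).+1; apply: le_lt_trans (ler_norm _) (truncnS_gt _).
    by exists n; lra.
rewrite lte_fin => ab; have ba0 : 0 < 3 * (b - a) by rewrite mulr_gt0// subr_gt0.
exists (fun n => b - 3 * (b - a) / n.+1%:R); split.
- by move=> n; rewrite ltrD2l ltrN2 ltr_pM2l// ltf_pV2 ?posrE// ltr_nat.
- lra.
- by move=> n; rewrite lte_fin ltrBlDr ltrDl divr_gt0.
- move=> r; rewrite lte_fin => rb.
  have br0 : 0 < b - r by rewrite subr_gt0.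
  have := truncnS_gt (3 * (b - a) / (b - r)); set n := Num.truncn _.
  rewrite ltr_pdivrMr// [_ * (b - r)]mulrC -ltr_pdivrMr// => bn; exists n.
  by rewrite ltrBrDr addrC -ltrBrDr.
Qed.

(** * The fine C^1 approximation *)

(** The Euclidean unit ball is contained in the unit cube. *)
Lemma operator_norm_le {R : realType} {d : nat} (L : {scalar 'rV[R]_d}) (m : R) :
  (forall v : 'rV[R]_d, (forall i, `|v ord0 i| <= 1) -> `|L v| <= m) ->
  operator_norm L <= m.
Proof.
move=> Lm; apply: ge_sup.
  exists `|L 0|, 0 => //=; rewrite /euclidean_norm big1 ?sqrtr0// => i _.
  by rewrite mxE expr0n.
move=> _ [v /= v1 <-]; apply: Lm => i.
rewrite -sqrtr_sqr; apply: le_trans v1; rewrite /euclidean_norm ler_wsqrtr//.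
by rewrite (bigD1 i)//= lerDl sumr_ge0// => j _; exact: sqr_ge0.
Qed.

Lemma open_superlevel {R : realType} {d : nat} (U : set 'rV[R]_d) (c : 'rV[R]_d -> R) (r : R) :
  open U -> (forall x, U x -> {for x, continuous c}) -> open (U `&` [set x | r < c x]).
Proof.
move=> oU cc; rewrite openE => x [Ux rx]; apply: filterI; first exact: near_open_in.
exact: (cvgr_gt _ (cc x Ux)).
Qed.

Lemma open_sublevel {R : realType} {d : nat} (U : set 'rV[R]_d) (c : 'rV[R]_d -> R) (r : R) :
  open U -> (forall x, U x -> {for x, continuous c}) -> open (U `&` [set x | c x < r]).
Proof.
move=> oU cc; rewrite openE => x [Ux rx]; apply: filterI; first exact: near_open_in.
exact: (cvgr_lt _ (cc x Ux)).
Qed.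

Unset Implicit Arguments.

Theorem theorem6 (R : realType) (d : nat) (U : set 'rV[R]_d)
    (f : 'rV[R]_d -> R)
    (openU : open U) (convexU : convex_set U)
    (pcf : properly_convex U f) (C1f : Ck 1 U f) :
  forall eps : 'rV[R]_d -> R,
    {within U, continuous eps} -> (forall x, U x -> 0 < eps x) ->
    exists g : 'rV[R]_d -> R,
      [/\ convex_function U g, Cinfty U g &
          forall x, U x ->
            `|f x - g x| <= eps x /\
            operator_norm ('d f x \- 'd g x) <= eps x].
Proof.
move=> eps ceps eps0.
have [l [c0 [a [b [ab fE c0ab cc0 cpt]]]]] := pcf.
have [df _] := C1f.
pose c x := f x - l x.
have cE x : U x -> c x = c0 x by move=> Ux; rewrite /c fE// addrAC subrr add0r.
have cf : convex_function U f.
  apply/convex_functionP => x y q Ux Uy q01.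
  have Uz := (convex_setP U).1 convexU x y q Ux Uy q01.
  rewrite !fE//; have /convex_functionP := convex_function_scalarD l cc0; exact.
have cc : convex_function U c.
  apply/convex_functionP => x y q Ux Uy q01.
  have Uz := (convex_setP U).1 convexU x y q Ux Uy q01.
  by rewrite !cE//; have /convex_functionP := cc0; exact.
have dl x : differentiable l x by apply: linear_differentiable; exact: scalar_continuous.
have dc x : U x -> differentiable c x.
  by move=> Ux; apply: differentiableB => //; exact: df.
have contc x : U x -> {for x, continuous c}.
  by move=> Ux; exact/differentiable_continuous/dc.
have [t [tS t1a tb tcof]] := exhausting_levels ab.
have ca x : U x -> a <= c x by move=> Ux; rewrite cE//; have [] := c0ab x Ux.
have tlt n m : (n < m)%N -> t n < t m by move: n m; exact: homo_ltn lt_trans tS.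
have tc x : U x -> t 0%N <= c x.
  by move=> Ux; apply: le_trans (ca x Ux); apply: ltW; apply: lt_trans t1a.
have tn x : U x -> exists n, c x < t n.
  by move=> Ux; apply: tcof; rewrite cE//; have [] := c0ab x Ux.
have cK n : compact (U `&` [set x | c x <= t n]).
  have [atn|tna] := leP a (t n); last first.
    rewrite (_ : _ `&` _ = set0); first exact: compact0.
    apply/seteqP; split=> x //= [Ux cx].
    by move: (ca x Ux); rewrite leNgt (le_lt_trans cx tna).
  rewrite (_ : _ `&` _ = U `&` c0 @^-1` `[a, t n]%classic); first exact: cpt.
  apply/seteqP; split=> x /= [Ux]; rewrite in_itv /= -cE// (ca x Ux)/= => cx; by split.
(* the compact shell K n is {t_{n+1} <= c <= t_{n+2}}, written with an open
   complement because c is only continuous on U *)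
pose V n := U `&` [set x | t n < c x].
pose K n := (U `&` [set x | c x <= t n.+2]) `&` ~` (U `&` [set x | c x < t n.+1]).
have ex n : exists r, 0 < r /\ forall g, convex_function U g ->
    (forall x, U x -> differentiable g x) ->
    (forall x, V n x -> `|f x - g x| <= r) ->
    forall x, K n x -> `|f x - g x| <= eps x /\
      forall v : 'rV[R]_d, (forall i, `|v ord0 i| <= 1) -> `|'d f x v - 'd g x v| <= eps x.
  have [||||r r0 Hr] := @uniform_C1_control R d U (V n) (K n) f eps openU cf C1f ceps eps0.
  - exact: open_superlevel.
  - exact: subIsetl.
  - by apply: compact_closedI => //; apply: open_closedC; exact: open_sublevel.
  - move=> x [[Ux cx] ncx]; split=> //=; rewrite ltNge; apply/negP => cn.
    by apply: ncx; split=> //=; apply: le_lt_trans cn _.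
  - by exists r.
have [e He] := choice ex.
have [g [cg gloc gc]] := fine_convex_approx openU convexU cc dc tS tc tn cK (fun n => (He n).1).
pose h x := l x + g x.
have ch : convex_function U h by exact: convex_function_scalarD.
have Ch : Cinfty U h.
  move=> k; apply: Ck_local => x Ux; have [u [_ Cu] ug] := gloc x Ux.
  exists (l \+ u); first by apply: CkD; [exact: Ck_scalar|exact: Cu].
  by apply: filterS ug => y /= ->.
have dh x : U x -> differentiable h x by have [+ _] := Ch 1; apply.
exists h; split=> // x Ux.
have fh y : f y - h y = c y - g y by rewrite /h /c opprD addrA.
have [n Kx] : exists n, K n x.
  have [|m cm mmin] := @ex_minnP (fun n => c x < t n); first exact: tn.
  case: m cm mmin => [|[|m]] cm mmin.
  - by move: (tc x Ux); rewrite leNgt cm.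
  - by move: (ca x Ux); rewrite leNgt (lt_trans cm t1a).
  exists m; split; first by split=> //; exact: ltW.
  by move=> [_ /= /mmin]; rewrite ltnn.
have [] := (He n).2 h ch dh _ x Kx.
  by move=> y [Uy ny]; rewrite fh; exact: gc.
by move=> fhx dfh; split=> //; apply: operator_norm_le => v v1; exact: dfh.
Qed.
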